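(* Let $n\ge3$. There exist $\varepsilon_0>0$, $r_0>0$ and a function $C:(0,\varepsilon_0]\to(0,\infty)$ with $C(\varepsilon)\to0$ as $\varepsilon\to0$, all depending only on $n$, such that the following holds. Let $\Omega\subset\mathbb{R}^n$ be open, let $u\in H^1(\Omega)\cap L^{2n/(n-2)}(\Omega)$ be a smooth (real-valued) solution of $-\Delta u=u|u|^{4/(n-2)}$ in $\Omega$, let $x_0\in\Omega$ with $B(x_0,r_0)\subset\Omega$, and let $\varepsilon\in(0,\varepsilon_0]$. If $$\int_{B(x_0,r_0)}\big(|\nabla u|^2+|u|^{2n/(n-2)}\big)\,dx\le\varepsilon,$$ then $$\|u\|_{L^\infty(B(x_0,r/2))}\le\frac{C(\varepsilon)}{r^{(n-2)/2}}\qquad\text{for every }0<r<r_0 .$$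
   Context: $B(x,r)$ denotes the open ball in $\mathbb{R}^n$ with center $x$ and radius $r$. *)

(* Defs.v *)
From HB Require Import structures.
From mathcomp Require Import all_boot all_order all_algebra.
From mathcomp Require Import all_classical all_reals all_analysis.

Set Implicit Arguments.
Unset Strict Implicit.
Unset Printing Implicit Defensive.
Import Order.TTheory GRing.Theory Num.Theory.
Import numFieldNormedType.Exports.

Local Open Scope classical_set_scope.
Local Open Scope ring_scope.

Definition rV_display : measure_display. Proof. exact. Qed.

(* R^n carries the product sigma-algebra, which is the Borel one
   ([open_measurable_rV] below). *)
Section measurable_rV.
Context (R : realType) (n : nat).

Definition coord_rV (i : 'I_n) (x : 'rV[R]_n) : measurableTypeR R := x ord0 i.

Let rV_set0 : g_sigma_preimage coord_rV set0.
Proof. exact: sigma_algebra0. Qed.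

Let rV_setC A : g_sigma_preimage coord_rV A -> g_sigma_preimage coord_rV (~` A).
Proof. exact: sigma_algebraC. Qed.

Let rV_bigcup (F : (set 'rV[R]_n)^nat) :
  (forall i, g_sigma_preimage coord_rV (F i)) ->
  g_sigma_preimage coord_rV (\bigcup_i (F i)).
Proof. exact: sigma_algebra_bigcup. Qed.

HB.instance Definition _ := @isMeasurable.Build rV_display
  'rV[R]_n (g_sigma_preimage coord_rV) rV_set0 rV_setC rV_bigcup.

End measurable_rV.


Lemma measurable_coord_rV (R : realType) (n : nat) (i : 'I_n) :
  measurable_fun [set: 'rV[R]_n] (coord_rV i).
Proof.
move=> _ Y mY; rewrite setTI; apply: sub_sigma_algebra => /=.
rewrite -bigcup_seq/=; exists i => /=; first by rewrite mem_index_enum.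
by exists Y => //; rewrite setTI.
Qed.

Lemma measurable_fun_rVP (R : realType) (n : nat) (d : measure_display)
    (T : measurableType d) (f : T -> 'rV[R]_n) :
  measurable_fun [set: T] f <->
  forall i, measurable_fun [set: T] (coord_rV i \o f).
Proof.
split=> [mf i|mf].
  by apply: measurableT_comp => //; exact: measurable_coord_rV.
move=> _ A mA; rewrite setTI.
have : preimage_set_system setT f (g_sigma_preimage (@coord_rV R n))
    (f @^-1` A) by exists A => //; rewrite setTI.
rewrite -g_sigma_preimage_comp; apply: smallest_sub.
  exact: sigma_algebra_measurable.
rewrite -bigcup_seq; apply: bigcup_sub => i _.
by move=> B [C mC <-]; exact: mf.
Qed.

Section lebesgue_rV.
Context (R : realType).

Definition cons_rV (n : nat) (p : measurableTypeR R * 'rV[R]_n)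
  : 'rV[R]_n.+1 := row_mx (const_mx p.1 : 'rV[R]_1) p.2.

Definition uncons_rV (n : nat) (x : 'rV[R]_n.+1)
  : measurableTypeR R * 'rV[R]_n :=
  (x ord0 ord0, rsubmx (x : 'rV[R]_(1 + n))).

Lemma cons_rV0 n a (x : 'rV[R]_n) : cons_rV (a, x) ord0 ord0 = a.
Proof. by rewrite mxE; case: splitP => // j _; rewrite mxE. Qed.

Lemma cons_rVS n a (x : 'rV[R]_n) i :
  cons_rV (a, x) ord0 (lift ord0 i) = x ord0 i.
Proof.
rewrite mxE; case: splitP => j /=; first by rewrite ord1.
by move=> /eqP; rewrite /bump/= eqn_add2l => /eqP/val_inj ->.
Qed.

Lemma cons_rVK n : cancel (@cons_rV n) (@uncons_rV n).
Proof. by move=> [a x]; rewrite /uncons_rV row_mxKr cons_rV0. Qed.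

Lemma measurable_cons_rV n : measurable_fun setT (@cons_rV n).
Proof.
apply/measurable_fun_rVP => i; case: (unliftP ord0 i) => [j|] ->.
  rewrite (_ : _ \o _ = coord_rV j \o snd).
    apply: measurableT_comp => //; exact: measurable_coord_rV.
  by apply/funext => -[a x]; exact: cons_rVS.
rewrite (_ : _ \o _ = fst) //; apply/funext => -[a x].
exact: cons_rV0.
Qed.

Lemma measurable_uncons_rV n : measurable_fun setT (@uncons_rV n).
Proof.
apply/measurable_fun_pairP; split; first exact: (@measurable_coord_rV R _ ord0).
apply/measurable_fun_rVP => i.
rewrite (_ : _ \o _ = coord_rV (rshift 1 i)).
  exact: measurable_coord_rV.
by apply/funext => x; rewrite /coord_rV/= mxE.
Qed.

Section cons_measure.
Variables (n : nat) (mu : {sigma_finite_measure set 'rV[R]_n -> \bar R}).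

Let mf := @measurable_cons_rV n.

Let prod_rV := pushforward (lebesgue_measure \x mu)%E (@cons_rV n).

Let prod_rV0 : prod_rV set0 = 0%E. Proof. exact: measure0. Qed.

Let prod_rV_ge0 A : (0 <= prod_rV A)%E. Proof. exact: measure_ge0. Qed.

Let prod_rV_sigma_additive : semi_sigma_additive prod_rV.
Proof. exact: measure_semi_sigma_additive. Qed.

HB.instance Definition _ := isMeasure.Build _ _ _ prod_rV
  prod_rV0 prod_rV_ge0 prod_rV_sigma_additive.

Let prod_rV_sigma_finite : sigma_finite setT prod_rV.
Proof.
have /sigma_finiteP[F [TF ndF Foo]] := sigma_finiteT (@lebesgue_measure R).
have /sigma_finiteP[G [TG ndG Goo]] := sigma_finiteT mu.
exists (fun k => @uncons_rV n @^-1` (F k `*` G k)).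
  apply/seteqP; split=> // x _.
  have [k _ Fkx] : (\bigcup_i F i) (uncons_rV x).1 by rewrite -TF.
  have [l _ Glx] : (\bigcup_i G i) (uncons_rV x).2 by rewrite -TG.
  exists (maxn k l) => //; split.
    by move: (uncons_rV x).1 Fkx; exact/subsetPset/ndF/leq_maxl.
  by move: (uncons_rV x).2 Glx; exact/subsetPset/ndG/leq_maxr.
move=> k; have [mF Fk] := Foo k; have [mG Gk] := Goo k; split.
  rewrite -[X in measurable X]setTI; apply: measurable_uncons_rV => //.
  exact: measurableX.
rewrite /prod_rV /pushforward (_ : _ @^-1` _ = F k `*` G k).
  by rewrite product_measure1E// lte_mul_pinfty// ge0_fin_numE.
rewrite -comp_preimage (_ : _ \o _ = id) ?preimage_id //.
by apply/funext; exact: cons_rVK.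
Qed.

HB.instance Definition _ :=
  Measure_isSigmaFinite.Build _ _ _ prod_rV prod_rV_sigma_finite.

Definition lebesgue_cons_rV : {sigma_finite_measure set 'rV[R]_n.+1 -> \bar R} :=
  prod_rV.

End cons_measure.

Fixpoint lebesgue_rV (n : nat) : {sigma_finite_measure set 'rV[R]_n -> \bar R} :=
  match n with
  | 0 => \d_(0 : 'rV[R]_0)
  | m.+1 => lebesgue_cons_rV (lebesgue_rV m)
  end.

Lemma measurable_box_rV (n : nat) (A : 'I_n -> set (measurableTypeR R)) :
  (forall i, measurable (A i)) ->
  measurable [set x : 'rV[R]_n | forall i, A i (x ord0 i)].
Proof.
move=> mA; rewrite [X in measurable X](_ : _ = \bigcap_(i in [set: 'I_n])
    (coord_rV i @^-1` A i)); last first.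
  by apply/seteqP; split=> x /= h i; [move=> _|]; exact: h.
apply: fin_bigcap_measurable => // i _.
by rewrite -[X in measurable X]setTI; exact: measurable_coord_rV.
Qed.

Lemma lebesgue_rV_box (n : nat) (A : 'I_n -> set (measurableTypeR R)) :
  (forall i, measurable (A i)) ->
  lebesgue_rV n [set x | forall i, A i (x ord0 i)] =
  (\prod_(i < n) lebesgue_measure (A i))%E.
Proof.
elim: n A => [|n IHn] A mA.
  rewrite big_ord0 /= diracE; rewrite (_ : _ \in _) //.
  by rewrite inE => -[].
rewrite big_ord_recl -(IHn (fun i => A (lift ord0 i))) //.
have mB := measurable_box_rV (fun i => mA (lift ord0 i)).
rewrite -(product_measure1E _ _ (mA ord0) mB).
rewrite /= /pushforward; congr (product_measure1 _ _ _).
apply/seteqP; split=> -[a x] /=.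
  move=> h; split; first by rewrite -(cons_rV0 a x); exact: h.
  by move=> i; rewrite -(cons_rVS a x); exact: h.
move=> [Aa Ax] i; case: (unliftP ord0 i) => [j|] ->; last by rewrite cons_rV0.
by rewrite cons_rVS.
Qed.

Lemma open_measurable_rV (n : nat) (A : set 'rV[R]_n) :
  open A -> measurable A.
Proof.
move=> oA.
pose box (p : 'rV[rat]_n * 'rV[rat]_n) : set 'rV[R]_n :=
  [set y | forall i, ratr (p.1 ord0 i) < y ord0 i < ratr (p.2 ord0 i)].
have -> : A = \bigcup_p (if `[< box p `<=` A >] then box p else set0).
  apply/seteqP; split=> [x Ax|x [p _]]; last first.
    by case: asboolP => // h /h.
  have /nbhs_ballP[e /= e0 xA] : nbhs x A by exact: open_nbhs_nbhs.
  have /choice[a aP] (i : 'I_n) :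
      exists q : rat, ratr q \in `]x ord0 i - e, x ord0 i[%R.
    by apply: rat_in_itvoo; rewrite ltrBlDr ltrDl.
  have /choice[b bP] (i : 'I_n) :
      exists q : rat, ratr q \in `]x ord0 i, x ord0 i + e[%R.
    by apply: rat_in_itvoo; rewrite ltrDl.
  exists (\row_i a i, \row_i b i) => //.
  have xbox : box (\row_i a i, \row_i b i) x.
    move=> i; rewrite /= !mxE; move: (aP i) (bP i); rewrite !in_itv/=.
    by move=> /andP[_ ->] /andP[->].
  case: asboolP => // -[] y ybox; apply: xA; split=> // i j.
  move: (ybox j) (aP j) (bP j); rewrite /= !mxE !in_itv/= (ord1 i).
  move=> /andP[ay yb] /andP[xa _] /andP[_ bx].
  rewrite /ball/= distrC ltr_distl (lt_trans xa ay)/=.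
  exact: lt_trans yb bx.
apply: countable_bigcupT_measurable => [|p]; first exact: countableP.
case: ifP => // _.
apply: (@measurable_box_rV _
  (fun i => [set t | ratr (p.1 ord0 i) < t < ratr (p.2 ord0 i)])) => i.
by have := @measurable_itv R `]ratr (p.1 ord0 i), ratr (p.2 ord0 i)[; rewrite set_itvoo.
Qed.

End lebesgue_rV.

Section euclidean.
Context {R : realType} {n : nat}.

(* The library norm on 'rV[R]_n is the sup norm; it induces the same topology,
   but balls and |grad u| need the Euclidean one. *)
Definition enorm (v : 'rV[R]_n) : R := Num.sqrt (\sum_i (v ord0 i) ^+ 2).

Definition eball (x : 'rV[R]_n) (r : R) : set 'rV[R]_n :=
  [set y | enorm (y - x) < r].

Definition partial (i : 'I_n) (f : 'rV[R]_n -> R) : 'rV[R]_n -> R :=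
  'D_(delta_mx ord0 i) f.

Definition partials (s : seq 'I_n) (f : 'rV[R]_n -> R) : 'rV[R]_n -> R :=
  foldr partial f s.

Definition grad (f : 'rV[R]_n -> R) (x : 'rV[R]_n) : 'rV[R]_n :=
  \row_i partial i f x.

Definition laplacian (f : 'rV[R]_n -> R) (x : 'rV[R]_n) : R :=
  \sum_i partial i (partial i f) x.

(* Meant for open [Omega]: derivatives at a point of [Omega] then only involve
   the values of [f] in [Omega]. *)
Definition smooth_on (Omega : set 'rV[R]_n) (f : 'rV[R]_n -> R) : Prop :=
  forall (s : seq 'I_n) (x : 'rV[R]_n), Omega x ->
    {for x, continuous (partials s f)} /\
    forall i, derivable (partials s f) x (delta_mx ord0 i).

Definition test_function (Omega : set 'rV[R]_n) (phi : 'rV[R]_n -> R) : Prop :=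
  [/\ smooth_on [set: 'rV[R]_n] phi,
      compact (closure [set x | phi x != 0]) &
      closure [set x | phi x != 0] `<=` Omega].

(* Functions on [Omega] are total functions extended by 0 outside [Omega]. *)
Definition in_Lp (Omega : set 'rV[R]_n) (p : R) (f : 'rV[R]_n -> R) : Prop :=
  f \_ Omega \in Lfun (lebesgue_rV R n) p%:E.

Definition Linf_norm (A : set 'rV[R]_n) (f : 'rV[R]_n -> R) : \bar R :=
  'N[lebesgue_rV R n]_(+oo%E)[EFin \o (f \_ A)]%E.

Definition weak_partial (Omega : set 'rV[R]_n) (i : 'I_n)
    (f g : 'rV[R]_n -> R) : Prop :=
  forall phi, test_function Omega phi ->
    \int[lebesgue_rV R n]_(x in Omega) (f x * partial i phi x) =
    - \int[lebesgue_rV R n]_(x in Omega) (g x * phi x).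

Definition in_H1 (Omega : set 'rV[R]_n) (f : 'rV[R]_n -> R) : Prop :=
  in_Lp Omega 2 f /\
  forall i, exists2 g, in_Lp Omega 2 g & weak_partial Omega i f g.

End euclidean.

(* The critical Sobolev exponent 2n/(n-2). *)
Definition sobolev_exp (R : realType) (n : nat) : R :=
  2 * n%:R / (n%:R - 2).

(* Main.v *)
Require Import Defs.
From mathcomp Require Import all_boot all_order all_algebra.
From mathcomp Require Import all_classical all_reals all_analysis.
From mathcomp Require Import ring lra.
Import Order.TTheory GRing.Theory Num.Theory.
Import numFieldNormedType.Exports.
Local Open Scope classical_set_scope.
Local Open Scope ring_scope.

(* Take [r0 = 1] and combine point picking with an elementary interior Lipschitz
   estimate.  Let [w x = 1/2 - |x - x0|^2] and let [x1] maximise [w^(n-2) u^2] over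
   [w >= 0]; put [W = w x1] and [m = |u x1|].  On the cube about [x1] of
   half-width [W / 6n] one has [w >= W / 2], hence [|u| <= 2^(n-2) m].  Put
   [s = min (W / 6n) (m^(-2/(n-2)))], so that [|Delta u| <= C m / s^2] on the cube
   of half-width [s].  Comparison with a quadratic barrier then bounds the
   Lipschitz constant of [u] near [x1] by [C m / s], so [|u| >= m / 2] on a cube
   of half-width [delta s], and the energy bound gives [m^p s^n <= C eps] with
   [p = 2n/(n-2)].  If [s = m^(-2/(n-2))] the left-hand side is [1], impossible
   for small [eps]; otherwise [(W^(n-2) m^2)^(p/2) = W^n m^p <= C eps], which
   bounds [u] on [B(x0, 1/2)], where [w >= 1/4]. *)

(** * Second derivatives at [0] in one variable, and restriction to lines *)

Section second_derivative.
Context {R : realType}.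
Implicit Types (f g : R -> R) (l : R).

(** Stated as a relation, so that sums, multiples and reflections become closure properties. Only
    [t] near [0] matters: [g] will be a restriction to a line, recentred at the point studied. *)
Definition has_second_derive g l := exists2 dg : R -> R,
  (\forall t \near (0 : R), is_derive t (1 : R) g (dg t)) & is_derive (0 : R) (1 : R) dg l.

Lemma has_second_deriveD f g k l : has_second_derive f k ->
  has_second_derive g l -> has_second_derive (f \+ g) (k + l).
Proof.
move=> [df nf f2] [dg ng g2]; exists (df \+ dg); last exact: is_deriveD.
by near=> t; apply: is_deriveD; near: t.
Unshelve. all: by end_near. Qed.

Lemma has_second_deriveZ (c : R) g l : has_second_derive g l ->
  has_second_derive (fun t => c * g t) (c * l).
Proof.
move=> [dg ng g2]; exists (fun t => c * dg t); last exact: (is_deriveZ c g2).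
near=> t; have gt : is_derive t (1 : R) g (dg t) by near: t.
exact: (is_deriveZ c gt).
Unshelve. all: by end_near. Qed.

Lemma has_second_derive_opp g l : has_second_derive g l ->
  has_second_derive (fun t => g (- t)) l.
Proof.
move=> [dg ng g2]; exists (fun t => - dg (- t)).
  have nng : \forall t \near (0 : R), is_derive (- t : R) (1 : R) g (dg (- t)).
    by have := @opp_continuous R (0 : R); rewrite /continuous_at oppr0 => /(_ _ ng).
  near=> t; have gt : is_derive (- t : R) (1 : R) g (dg (- t)) by near: t.
  rewrite -[- dg _]mulrN1; apply: (@is_derive1_comp _ g -%R t) => //.
rewrite -[l]opprK; apply: is_deriveN; rewrite -[- l]mulrN1.
by apply: (@is_derive1_comp _ dg -%R 0); rewrite oppr0.
Unshelve. all: by end_near. Qed.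

Lemma has_second_derive_quadratic (a b c : R) :
  has_second_derive (fun t => a + b * t + c * t ^+ 2) (2 * c).
Proof.
exists (fun t => b + 2 * c * t).
  near=> t; apply: is_derive_eq; rewrite /GRing.scale/= !mulr1; ring.
by apply: is_derive_eq; rewrite /GRing.scale/= !mulr1; ring.
Unshelve. all: by end_near. Qed.

(** At the maximum [dg 0 = 0]. If [l > 0], then [dg] is positive just to the right of [0], and the
    mean value theorem produces [t] with [g t > g 0]. *)
Lemma second_derive_at_max g l : has_second_derive g l ->
  (\forall t \near (0 : R), g t <= g 0) -> l <= 0.
Proof.
move=> [dg ng g2] gmax; rewrite leNgt; apply/negP => l0.
have [e /= e0 he] : nbhs_ball (0 : R)
    [set t : R | is_derive t (1 : R) g (dg t) /\ g t <= g 0].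
  by apply/nbhs_ballP; near=> t; split; near: t.
have inball t : t \in `]-e, e[ -> ball (0 : R) e t.
  by rewrite in_itv/= /ball/= sub0r normrN ltr_norml.
have dg0 : dg 0 = 0.
  have [|_ <-] := (he 0 _).1; first exact: ballxx.
  suff [_] : is_derive (0 : R) (1 : R) g 0 by [].
  apply: (@derive1_at_max _ g (- e) e).
  - lra.
  - by move=> t /inball/he[[]].
  - by rewrite in_itv/=; lra.
  - by move=> t /inball/he[].
have dgpos : \forall h \near (0 : R)^', 0 < h^-1 * dg h.
  case: g2 => dg2 Dl.
  have hk : h^-1 *: ((dg \o shift 0) (h *: 1) - dg 0) @[h --> (0 : R)^'] --> l.
    by rewrite -Dl; exact: dg2.
  have F0 : Filter (0 : R)^' by exact: _.
  have /(_ F0 _ l0) hpos := cvgr_gt _ hk.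
  near=> h; rewrite (_ : _ * _ = h^-1 *: ((dg \o shift 0) (h *: 1) - dg 0)).
    by near: h.
  by rewrite /= dg0 subr0 addr0 /GRing.scale/= mulr1.
have [e' /= e'0 he'] : nbhs_ball (0 : R) [set h | h != 0 -> 0 < h^-1 * dg h].
  exact/nbhs_ballP.
have [t [t0 te te']] : exists t, [/\ 0 < t, t < e & t < e'].
  exists (Num.min (e / 2) (e' / 2)); split.
  - by rewrite lt_min; apply/andP; split; lra.
  - by rewrite gt_min; apply/orP; left; lra.
  - by rewrite gt_min; apply/orP; right; lra.
have dgx (x : R) : x \in `[0, t] -> is_derive (x : R) (1 : R) g (dg x).
  rewrite in_itv/= => xt; apply: (he x _).1; apply: inball.
  by rewrite in_itv/=; lra.
have dgx' (x : R) : x \in `]0, t[ -> is_derive (x : R) (1 : R) g (dg x).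
  by move=> xt; apply: dgx; move: xt; rewrite !in_itv/=; lra.
have gc : {within `[0, t], continuous g}.
  by apply: derivable_within_continuous => x /dgx[].
have [c c0t gE] := MVT t0 dgx' gc.
rewrite in_itv/= in c0t.
have dgc : 0 < dg c.
  have : 0 < c^-1 * dg c.
    apply: he'; last by rewrite gt_eqF//; lra.
    by rewrite /ball/= sub0r normrN ltr_norml; lra.
  by rewrite pmulr_rgt0// invr_gt0; lra.
have [|_ gt] := he t.
  by apply: inball; rewrite in_itv/=; lra.
rewrite subr0 in gE; have : 0 < dg c * t by rewrite mulr_gt0.
by lra.
Unshelve. all: by end_near. Qed.

Lemma has_second_derive_line (V : normedModType R) (u : V -> R) (x v : V) :
  (\forall t \near (0 : R), derivable u (t *: v + x) v) ->
  derivable ('D_v u) x v ->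
  has_second_derive (fun t => u (t *: v + x)) ('D_v ('D_v u) x).
Proof.
move=> du d2u.
have line (w : V -> R) (t : R) : derivable w (t *: v + x) v ->
    is_derive (t : R) (1 : R) (fun t => w (t *: v + x)) ('D_v w (t *: v + x)).
  (* The two difference quotients are the same function of [h], so derivability and the value
     transfer together. *)
  have E : (fun h : R => h^-1 *: (((fun t => w (t *: v + x)) \o shift t) (h *: 1)
        - w (t *: v + x))) =
      (fun h : R => h^-1 *: ((w \o shift (t *: v + x)) (h *: v) - w (t *: v + x))).
    apply/funext => h /=; rewrite (_ : h *: 1 = h) ?scalerDl ?addrA//.
    exact: mulr1.
  by move=> dw; apply: DeriveDef; rewrite /derivable /derive E.
exists (fun t => 'D_v u (t *: v + x)).
  by near=> t; apply: line; near: t.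
have := line ('D_v u) 0; rewrite scale0r add0r => h; exact: h.
Unshelve. all: by end_near. Qed.

End second_derivative.

(** * Reflections, a quadratic barrier and oscillation on cubes *)

Section comparison.
Context {R : realType} {n : nat}.
Implicit Types (x y c : 'rV[R]_n) (i j k : 'I_n) (d : R) (u : 'rV[R]_n -> R).

Local Notation e_ i := (delta_mx ord0 i : 'rV[R]_n).

Definition box c d : set 'rV[R]_n := [set y | forall i, `|y ord0 i - c ord0 i| <= d].

Definition refl k x : 'rV[R]_n := (- (2 * x ord0 k)) *: e_ k + x.

Lemma reflE k x j : refl k x ord0 j = if j == k then - x ord0 k else x ord0 j.
Proof.
rewrite !mxE eqxx/=; case: eqP => [->|_]/=; first by rewrite mulr1; ring.
by rewrite mulr0 add0r.
Qed.

Lemma refl_continuous k : continuous (refl k).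
Proof.
move=> x; apply: (@cvgD _ _ _ (nbhs x)) => //.
apply: (@cvgZr_tmp _ _ _ (nbhs x)); apply: (@cvgN _ _ _ (nbhs x)).
apply: (@cvgM _ _ (nbhs x)); first exact: cvg_cst.
exact: coord_continuous.
Qed.

Lemma refl_line k i x (t : R) : refl k (t *: e_ i + x) =
  (if i == k then - t else t) *: e_ i + refl k x.
Proof.
apply/rowP => j; rewrite reflE [RHS]mxE reflE !mxE !eqxx/=.
case: (eqVneq i k) => [->|ik].
  by case: (eqVneq j k) => [jk|_]; rewrite ?jk ?eqxx /=; ring.
case: (eqVneq j k) => [->|//].
by rewrite eq_sym (negPf ik)/=; ring.
Qed.

Lemma sum_sqr_continuous : continuous (fun x => \sum_j x ord0 j ^+ 2).
Proof.
apply: continuous_big => [|i _ x]; first exact: add_continuous.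
apply: (@continuous_comp _ _ _ (fun x : 'rV[R]_n => x ord0 i) (fun r : R => r ^+ 2)).
  exact: coord_continuous.
exact: exprn_continuous.
Qed.

Lemma sum_sqr_line i x (t : R) :
  \sum_j ((t *: e_ i + x) ord0 j) ^+ 2 =
  \sum_j (x ord0 j) ^+ 2 + 2 * x ord0 i * t + t ^+ 2.
Proof.
rewrite (bigD1 i)//= [in RHS](bigD1 i)//= !mxE !eqxx/=.
rewrite (eq_bigr (fun j => x ord0 j ^+ 2)); last first.
  by move=> j ji; rewrite !mxE (negPf ji) andbF mulr0 add0r.
by ring.
Qed.

(** The first term is at least [M] on the faces [|x_j| = d]. The coefficient of the second cancels
    the Laplacian [2 n M / d^2] of the first and leaves [- N]. *)
Definition barrier k d (M N : R) x : R :=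
  M / d ^+ 2 * (\sum_j (x ord0 j) ^+ 2)
  + (n%:R * M / d ^+ 2 + N / 2) * (x ord0 k * (d - x ord0 k)).

Lemma barrier_continuous k d M N : continuous (barrier k d M N).
Proof.
move=> x; apply: (@cvgD _ _ _ (nbhs x)); apply: (@cvgM _ _ (nbhs x)).
- exact: cvg_cst.
- exact: sum_sqr_continuous.
- exact: cvg_cst.
- apply: (@cvgM _ _ (nbhs x)); first exact: coord_continuous.
  apply: (@cvgB _ _ _ (nbhs x)); first exact: cvg_cst.
  exact: coord_continuous.
Qed.

Lemma barrier_line k d M N i x :
  has_second_derive (fun t : R => barrier k d M N (t *: e_ i + x))
    (2 * (M / d ^+ 2 - (n%:R * M / d ^+ 2 + N / 2) * (i == k)%:R)).
Proof.
set a := M / d ^+ 2; set q := _ + N / 2.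
rewrite (_ : (fun t => _) = fun t => barrier k d M N x
  + (2 * a * x ord0 i + q * (i == k)%:R * (d - 2 * x ord0 k)) * t
  + (a - q * (i == k)%:R) * t ^+ 2); first exact: has_second_derive_quadratic.
apply/funext => t; rewrite /barrier -/a -/q sum_sqr_line !mxE eqxx/= [k == i]eq_sym.
by case: (i == k) => /=; ring.
Qed.

Lemma sum_barrier_line k d (M N : R) :
  \sum_i 2 * (M / d ^+ 2 - (n%:R * M / d ^+ 2 + N / 2) * (i == k)%:R) = - N.
Proof.
rewrite -mulr_sumr big_split/= sumr_const card_ord sumrN -mulr_sumr.
rewrite (bigD1 k)//= eqxx big1 => [|i /negPf->//].
by move: (d ^+ 2)^-1 => a; rewrite -(mulr_natl (M * a)) mulr1n; field.
Qed.

(* Comparison of the odd part of [u] in the direction [k] with [barrier], on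
   the half-box [0 <= x_k <= d] (Gilbarg-Trudinger, Section 3.4): the barrier
   has Laplacian [- N], is nonnegative on [x_k = 0], where the odd part
   vanishes, and is at least [M] on the other faces. *)
Lemma odd_part_le u (D : 'I_n -> 'rV[R]_n -> R) c k d (M N t : R) : 0 < d ->
  (forall y, box c d y -> {for y, continuous u}) ->
  (forall y, box c d y -> `|u y| <= M) ->
  (forall y i, box c d y ->
     has_second_derive (fun t : R => u (t *: e_ i + y)) (D i y)) ->
  (forall y, box c d y -> `|\sum_i D i y| < N) ->
  0 <= t <= d ->
  u (t *: e_ k + c) - u (- t *: e_ k + c) <= 2 * t * (n%:R * M / d + N * d / 2).
Proof.
move=> d0 cu uM d2u lapN /andP[t0 td].
have n1 : 1 <= n%:R :> R by rewrite ler1n; case: (n) k => [[]|].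
have M0 : 0 <= M.
  apply: (le_trans (normr_ge0 (u c))); apply: uM => i.
  by rewrite subrr normr0 ltW.
have N0 : 0 < N.
  apply: (le_lt_trans (normr_ge0 (\sum_i D i c))); apply: lapN => i.
  by rewrite subrr normr0 ltW.
(* The half-box, translated so that [c] becomes the origin. *)
pose B : set 'rV[R]_n := [set x | forall i,
  (if i == k then `[0, d]%classic else `[- d, d]%classic) (x ord0 i)].
have BP x : B x -> 0 <= x ord0 k <= d /\ forall i, `|x ord0 i| <= d.
  move=> Bx; have := Bx k; rewrite eqxx /= in_itv/= => xk; split => // i.
  have := Bx i; rewrite ler_norml; case: ifP => _ /=; rewrite in_itv/=; lra.
have cB : compact B.
  apply: (@rV_compact R n
    (fun i => if i == k then `[0, d]%classic else `[- d, d]%classic)) => i.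
  by case: ifP => _; exact: segment_compact.
have boxB x : B x -> box c d (x + c).
  by move=> /BP[_ xd] i; rewrite !mxE addrK.
have boxrB x : B x -> box c d (refl k x + c).
  move=> /BP[_ xd] i; rewrite mxE addrK reflE.
  by case: ifP => // _; rewrite normrN.
pose F x := 2^-1 * (u (x + c) - u (refl k x + c)) - barrier k d M N x.
have B0 : B 0.
  move=> i; rewrite mxE; case: ifP => _ /=; rewrite in_itv/=; lra.
have cF : {within B, continuous F}.
  apply: continuous_in_subspaceT => x /set_mem Bx.
  apply: (@cvgB _ _ _ (nbhs x)); last exact: barrier_continuous.
  apply: (@cvgM _ _ (nbhs x)); first exact: cvg_cst.
  have shift_cont (g : 'rV[R]_n -> 'rV[R]_n) : {for x, continuous g} ->
      {for g x + c, continuous u} -> {for x, continuous (fun x => u (g x + c))}.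
    move=> cg cuc; apply: (@continuous_comp _ _ _ (fun x => g x + c) u) => //.
    by apply: (@cvgD _ _ _ (nbhs x)); [exact: cg|exact: cvg_cst].
  apply: (@cvgB _ _ _ (nbhs x)).
    by apply: (shift_cont id); [exact: cvg_id|exact/cu/boxB].
  by apply: shift_cont; [exact: refl_continuous|exact/cu/boxrB].
have [x1 /set_mem Bx1 maxF] := EVT_max_rV (ex_intro _ 0 B0) cB cF.
have a0 : 0 <= M / d ^+ 2 by rewrite divr_ge0// exprn_ge0// ltW.
have q0 : 0 <= n%:R * M / d ^+ 2 + N / 2.
  by rewrite -mulrA addr_ge0 ?divr_ge0 ?(ltW N0)// mulr_ge0.
have sum_ge0 (P : pred 'I_n) x : 0 <= \sum_(j | P j) x ord0 j ^+ 2.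
  by apply: sumr_ge0 => i _; exact: sqr_ge0.
have barrier_ge0 x : B x -> 0 <= barrier k d M N x.
  move=> /BP[/andP[xk0 xkd] _]; apply: addr_ge0.
    by rewrite mulr_ge0.
  by rewrite mulr_ge0// mulr_ge0// subr_ge0.
have barrier_geM x j : B x -> `|x ord0 j| = d -> M <= barrier k d M N x.
  move=> Bx xj; have [/andP[xk0 xkd] _] := BP _ Bx.
  rewrite /barrier (bigD1 j)//= -[X in X + \sum_(_ | _) _]real_normK ?num_real// xj mulrDr.
  rewrite divfK ?sqrf_eq0 ?gt_eqF// -addrA lerDl addr_ge0//.
    by rewrite mulr_ge0.
  by rewrite mulr_ge0// mulr_ge0// subr_ge0.
have half x : B x -> 2^-1 * (u (x + c) - u (refl k x + c)) <= M.
  move=> Bx; have := uM _ (boxB _ Bx); have := uM _ (boxrB _ Bx).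
  by rewrite !ler_norml; lra.
have Fx1 : F x1 <= 0.
  (* On the face [x_k = 0] the reflection fixes [x1], so [F x1] is minus the barrier; on the other
     faces the barrier is at least [M], which bounds the odd part. *)
  have [xk0|/eqP xk0] := eqVneq (x1 ord0 k) 0.
    rewrite /F (_ : refl k x1 = x1) ?subrr ?mulr0 ?sub0r ?oppr_le0 ?barrier_ge0//.
    by rewrite /refl xk0 mulr0 oppr0 scale0r add0r.
  have [/existsP[j /eqP xj]|] := boolP [exists j, `|x1 ord0 j| == d].
    by rewrite /F subr_le0 (le_trans (half _ Bx1))// (barrier_geM _ j).
  rewrite negb_exists => /forallP xlt.
  have [/andP[xk_ge0 xkd] xd] := BP _ Bx1.
  have xlt' j : `|x1 ord0 j| < d by rewrite lt_neqAle xlt xd.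
  have xk_gt0 : 0 < x1 ord0 k by rewrite lt_neqAle eq_sym; apply/andP; split => //; apply/eqP.
  (* At an interior maximum every second derivative [l i] of [F] is nonpositive. Their sum is [N]
     plus half the difference of two numbers of absolute value below [N], hence positive: a
     contradiction. *)
  pose l i := 2^-1 * (D i (x1 + c) - D i (refl k x1 + c))
    - 2 * (M / d ^+ 2 - (n%:R * M / d ^+ 2 + N / 2) * (i == k)%:R).
  have l_le0 i : l i <= 0.
    apply: (@second_derive_at_max R (fun t => F (t *: e_ i + x1))).
      apply: has_second_deriveD; last first.
        rewrite -mulN1r; under eq_fun do rewrite -mulN1r.
        exact/has_second_deriveZ/barrier_line.
      apply: has_second_deriveZ; apply: has_second_deriveD.
        by under eq_fun do rewrite -addrA; exact/d2u/boxB.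
      rewrite -mulN1r; under eq_fun do rewrite -mulN1r refl_line -addrA.
      apply: has_second_deriveZ; have d2 := d2u _ i (boxrB _ Bx1).
      by case: (i == k); [exact: (has_second_derive_opp _ _ d2)|].
    have near0 (e : R) : 0 < e -> \forall s \near (0 : R), `|s| < e.
      move=> e0; apply/nbhs_ballP; exists e => // s.
      by rewrite /ball/= sub0r normrN.
    have near1 := near0 _ (etrans (subr_gt0 _ _) (xlt' i)).
    have near2 := near0 _ xk_gt0.
    rewrite scale0r add0r; near=> s; apply: maxF; apply/mem_set => j.
    have s1 : `|s| < d - `|x1 ord0 i| by near: s; exact: near1.
    have s2 : `|s| < x1 ord0 k by near: s; exact: near2.
    have := ler_norm (x1 ord0 i); have := ler_norm (- x1 ord0 i); rewrite normrN.
    have := xd j; rewrite ler_norml => xj.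
    move: s1 s2; rewrite !ltr_norml !mxE eqxx/= => s1 s2 xi1 xi2.
    case: (eqVneq j k) => [jk|_]; rewrite /= in_itv/=.
      move: xj; rewrite jk => xj.
      by case: (eqVneq k i) => [ki|_]; rewrite ?ki in s1 s2 xj xi1 xi2 xk_gt0 *;
        rewrite ?mulr1 ?mulr0; lra.
    by case: (eqVneq j i) => [ji|_]; rewrite ?ji in s1 s2 xj xi1 xi2 *; rewrite ?mulr1 ?mulr0; lra.
  have : \sum_i l i =
      2^-1 * (\sum_i D i (x1 + c) - \sum_i D i (refl k x1 + c)) - - N.
    by rewrite sumrB sum_barrier_line -mulr_sumr sumrB.
  have : \sum_i l i <= 0 by apply: sumr_le0 => i _.
  have := lapN _ (boxB _ Bx1); have := lapN _ (boxrB _ Bx1).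
  move: (\sum_i l i) (\sum_i D i (x1 + c)) (\sum_i D i _) => S L1 L2.
  by rewrite !ltr_norml => L2N L1N S0 SE; clear -L1N L2N S0 SE; lra.
have Bt : B (t *: e_ k).
  by move=> i; rewrite !mxE eqxx/=; case: (i == k) => /=; rewrite in_itv/=; lra.
have := le_trans (maxF _ (mem_set Bt)) Fx1.
rewrite /F /refl /barrier !mxE !eqxx/= mulr1 -scalerDl.
rewrite (_ : - (2 * t) + t = - t); last by ring.
rewrite (bigD1 k)//= big1 => [|i /negPf ik]; last by rewrite !mxE ik andbF mulr0 expr0n.
rewrite !mxE !eqxx/= mulr1 addr0.
set U := u _ - _ => hU.
have {hU} : U <= 2 * (M / d ^+ 2 * t ^+ 2 + (n%:R * M / d ^+ 2 + N / 2) * (t * (d - t))).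
  by move: hU; lra.
move/le_trans; apply.
rewrite -[leRHS]mulrA ler_pM2l//.
(* The barrier at [t *: e_ k] falls short of the linear bound by exactly the last summand,
   nonnegative since [n >= 1]. *)
have -> : t * (n%:R * M / d + N * d / 2) = M / d ^+ 2 * t ^+ 2 +
  (n%:R * M / d ^+ 2 + N / 2) * (t * (d - t))
  + ((n%:R - 1) * (M / d ^+ 2 * t ^+ 2) + N / 2 * t ^+ 2).
  by field; rewrite gt_eqF.
rewrite lerDl addr_ge0// mulr_ge0 ?subr_ge0 ?sqr_ge0//.
  by rewrite mulr_ge0// sqr_ge0.
by rewrite divr_ge0// ltW.
Unshelve. all: by end_near. Qed.

(** The one-sided bound for [u] and [- u] gives the absolute value; exchanging the two points covers
    negative [h]. *)
Lemma symmetric_difference_le u (D : 'I_n -> 'rV[R]_n -> R) c k d (M N h : R) :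
  0 < d ->
  (forall y, box c d y -> {for y, continuous u}) ->
  (forall y, box c d y -> `|u y| <= M) ->
  (forall y i, box c d y ->
     has_second_derive (fun t : R => u (t *: e_ i + y)) (D i y)) ->
  (forall y, box c d y -> `|\sum_i D i y| < N) ->
  `|h| <= d ->
  `|u (h *: e_ k + c) - u (- h *: e_ k + c)|
    <= 2 * `|h| * (n%:R * M / d + N * d / 2).
Proof.
move=> d0 cu uM d2u lapN hd.
have dir (t : R) : 0 <= t <= d -> `|u (t *: e_ k + c) - u (- t *: e_ k + c)|
    <= 2 * t * (n%:R * M / d + N * d / 2).
  move=> td; rewrite ler_norml lerNl opprB.
  rewrite (odd_part_le u D)// andbT.
  have := odd_part_le (fun y => - u y) (fun i y => - D i y) c k d M N t d0.
  rewrite opprK addrC; apply => //.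
  - by move=> y /cu cuy; apply: (@cvgN _ _ _ (nbhs y)).
  - by move=> y /uM; rewrite normrN.
  - move=> y i /d2u - /(_ i) /(has_second_deriveZ (-1)); rewrite mulN1r.
    by under eq_fun do rewrite mulN1r.
  - by move=> y /lapN; rewrite sumrN normrN.
have [h0|h0] := leP 0 h.
  by rewrite (ger0_norm h0); apply: dir; rewrite h0 -(ger0_norm h0).
have nh0 : 0 <= - h by rewrite oppr_ge0 ltW.
rewrite distrC -{2}[h]opprK (ltr0_norm h0); apply: dir.
by rewrite nh0 -(ltr0_norm h0).
Qed.

(** The coordinates of [c] are replaced by those of [y] one at a time. Each change is a symmetric
    difference about a midpoint and costs at most [r] times the slope [L]. *)
Lemma box_oscillation_le u (D : 'I_n -> 'rV[R]_n -> R) c y (s r M N : R) :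
  0 < s -> r <= s / 2 ->
  (forall y, box c s y -> {for y, continuous u}) ->
  (forall y, box c s y -> `|u y| <= M) ->
  (forall y i, box c s y ->
     has_second_derive (fun t : R => u (t *: e_ i + y)) (D i y)) ->
  (forall y, box c s y -> `|\sum_i D i y| < N) ->
  box c r y ->
  `|u y - u c| <= n%:R * (r * (n%:R * M / (s / 2) + N * (s / 2) / 2)).
Proof.
move=> s0 rs cu uM d2u lapN cry; set L := _ + N * (s / 2) / 2.
have s20 : 0 < s / 2 by rewrite divr_gt0.
pose z (j : nat) : 'rV[R]_n := \row_i (if (i < j)%N then y ord0 i else c ord0 i).
suff zle (j : nat) : (j <= n)%N -> `|u (z j) - u c| <= j%:R * (r * L).
  have := zle n (leqnn _); rewrite (_ : z n = y)//.
  by apply/rowP => i; rewrite mxE ltn_ord.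
elim: j => [_|j IHj jn].
  rewrite mul0r (_ : z 0%N = c) ?subrr ?normr0//.
  by apply/rowP => i; rewrite mxE.
have {IHj} := IHj (ltnW jn).
(* With [h] half the displacement, [z j] and [z j.+1] are mirror images about [m]. *)
pose k := Ordinal jn; pose h := (y ord0 k - c ord0 k) / 2.
pose m := h *: e_ k + z j.
have z1 : z j.+1 = h *: e_ k + m.
  apply/rowP => i; rewrite !mxE eqxx/= ltnS leq_eqVlt -[(i : nat) == j]/(i == k).
  case: (eqVneq i k) => [->|_]/=; last by rewrite !mulr0 !add0r.
  by rewrite ltnn /h; field.
have z0 : z j = - h *: e_ k + m by rewrite /m addrA -scalerDl addNr scale0r add0r.
have yck := cry k.
have hr : `|h| <= r / 2 by rewrite /h normrM [X in _ * X]ger0_norm// ler_pM2r.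
have r0 : 0 <= r by exact: le_trans (normr_ge0 _) yck.
(* Each coordinate of [m] is within [r <= s / 2] of that of [c], which leaves room for a cube of
   half-width [s / 2]. *)
have sub w : box m (s / 2) w -> box c s w.
  move=> mw i; rewrite -(subrKA (m ord0 i)) (le_trans (ler_normD _ _))//.
  rewrite [leRHS]splitr lerD// (le_trans _ rs)// !mxE eqxx/=.
  case: (eqVneq i k) => [->|_]/=.
    rewrite ltnn mulr1 addrK; lra.
  rewrite mulr0 add0r; case: ifP => _; first exact: cry.
  by rewrite subrr normr0.
have := @symmetric_difference_le u D m k (s / 2) M N h s20
  (fun w mw => cu w (sub w mw)) (fun w mw => uM w (sub w mw))
  (fun w i mw => d2u w i (sub w mw)) (fun w mw => lapN w (sub w mw)).
rewrite -z1 -z0 -/L => /(_ _) zz zj.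
have {}zz : `|u (z j.+1) - u (z j)| <= 2 * `|h| * L by apply: zz; lra.
have L0 : 0 <= L.
  have boxcc : box c s c by move=> i; rewrite subrr normr0 ltW.
  have M0 := le_trans (normr_ge0 _) (uM _ boxcc).
  have N0 := le_lt_trans (normr_ge0 _) (lapN _ boxcc).
  by rewrite addr_ge0// ?divr_ge0// ?mulr_ge0// ltW.
rewrite -natr1 mulrDl mul1r -(subrKA (u (z j))) (le_trans (ler_normD _ _))//.
rewrite addrC lerD// (le_trans zz)// ler_wpM2r//; lra.
Qed.

End comparison.

(** * Lower bounds for integrals and for solutions near a point *)

Section lower_bounds.
Context {R : realType}.

(** The integral of a nonnegative function is a supremum over the simple functions below it, and
    those below [c] on [A] and [0] elsewhere are also below [f] on [D]. The argument covers any
    nonnegative [f]. *)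
Lemma ge_cst_integral d (T : measurableType d) (mu : {measure set T -> \bar R})
    (D A : set T) (f : T -> \bar R) (c : R) :
  measurable A -> A `<=` D -> 0 <= c ->
  (forall x, D x -> (0 <= f x)%E) -> (forall x, A x -> (c%:E <= f x)%E) ->
  (c%:E * mu A <= \int[mu]_(x in D) f x)%E.
Proof.
move=> mA AD c0 f0 cf; rewrite -integral_cst// integral_mkcond [leRHS]integral_mkcond.
have cA0 x : (0 <= ((fun=> c%:E) \_ A) x)%E.
  by rewrite patchE; case: ifP.
have fD0 x : (0 <= (f \_ D) x)%E.
  by rewrite patchE; case: ifP => // /set_mem/f0.
rewrite !ge0_integralTE//; apply: ereal_sup_le => _ /= [h hcA <-].
exists h => // x.
apply: (le_trans (hcA x)); rewrite !patchE; case: ifPn => [/set_mem Ax|_].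
  by rewrite mem_set ?cf//; exact: AD.
by case: ifP => // /set_mem/f0.
Qed.

Lemma box_itv n (c : 'rV[R]_n) (r : R) :
  box c r = [set x | forall i, `[c ord0 i - r, c ord0 i + r]%classic (x ord0 i)].
Proof.
by apply/seteqP; split => x bx i; have := bx i; rewrite /= in_itv/= ler_distl.
Qed.

Lemma measurable_box n (c : 'rV[R]_n) (r : R) : measurable (box c r).
Proof.
rewrite box_itv.
apply: (@measurable_box_rV _ _ (fun i => `[c ord0 i - r, c ord0 i + r]%classic)) => i.
exact: measurable_itv.
Qed.

Lemma lebesgue_box n (c : 'rV[R]_n) (r : R) : 0 <= r ->
  lebesgue_rV R n (box c r) = ((2 * r) ^+ n)%:E.
Proof.
move=> r0; rewrite box_itv.
rewrite (lebesgue_rV_box (A := fun i => `[c ord0 i - r, c ord0 i + r]%classic)); last first.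
  by move=> i; exact: measurable_itv.
rewrite (eq_bigr (fun=> (2 * r)%:E)) => [|i _].
  by rewrite prodEFin prodr_const card_ord.
rewrite lebesgue_measure_itv/= lte_fin.
by case: ifPn => [_|]; rewrite -?EFinB -?leNgt => *; congr (_%:E); lra.
Qed.

(** Openness keeps a short segment through [y] inside [Omega], where the first partial derivatives
    exist. *)
Lemma smooth_second_derive n (Omega : set 'rV[R]_n) u (y : 'rV[R]_n) i :
  open Omega -> smooth_on Omega u -> Omega y ->
  has_second_derive (fun t : R => u (t *: delta_mx ord0 i + y))
    (partial i (partial i u) y).
Proof.
move=> oO su Oy; apply: has_second_derive_line; last first.
  exact: (su [:: i] y Oy).2.
have line_cont : {for (0 : R), continuous
    (fun t : R => t *: (delta_mx ord0 i : 'rV[R]_n) + y)}.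
  apply: (@cvgD _ _ _ (nbhs (0 : R))); last exact: cvg_cst.
  by apply: (@cvgZr_tmp _ _ _ (nbhs (0 : R))); exact: cvg_id.
have near_O : \forall t \near (0 : R), Omega (t *: delta_mx ord0 i + y).
  apply: line_cont; apply: open_nbhs_nbhs; split => //.
  by rewrite scale0r add0r.
by near=> t; apply: (su [::] _ _).2; near: t.
Unshelve. all: by end_near. Qed.

(* The ratio, in units of the scale [s], of the radius on which a solution
   bounded by [A] times its central value keeps half of that value. *)
Definition half_ratio (n : nat) (A a : R) : R :=
  (2 * n%:R * (2 * n%:R * A + A * A `^ a / 2))^-1.

Lemma half_ratio_gt0 n A a : (0 < n)%N -> 1 <= A -> 0 < half_ratio n A a.
Proof.
move=> n0 A1; have A0 : 0 < A by lra.
rewrite invr_gt0 !mulr_gt0// ?ltr0n// addr_gt0// ?divr_gt0 ?mulr_gt0 ?ltr0n//.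
exact: powR_gt0.
Qed.

Lemma half_ratio_le_half n A a : (0 < n)%N -> 1 <= A -> half_ratio n A a <= 2^-1.
Proof.
move=> n0 A1; have n1 : 1 <= n%:R :> R by rewrite ler1n.
have Aa : 0 <= A * A `^ a / 2 by rewrite divr_ge0// mulr_ge0 ?powR_ge0//; lra.
have K1 : 1 <= 2 * n%:R * A + A * A `^ a / 2 by nra.
by rewrite lef_pV2 ?posrE//; nra.
Qed.

(** With [m] for the central value, the scale condition on [s] gives
    [|laplacian u| <= A^(1+a) m / s^2] on the cube, and [half_ratio] makes the resulting oscillation
    bound equal to [m / 2]. *)
Lemma half_lower_bound n (Omega : set 'rV[R]_n) u (c y : 'rV[R]_n) (s A a : R) :
  (0 < n)%N -> open Omega -> smooth_on Omega u ->
  0 <= a -> 1 <= A -> 0 < s -> 0 < `|u c| ->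
  s ^+ 2 * `|u c| `^ a <= 1 ->
  box c s `<=` Omega ->
  (forall y, box c s y -> `|u y| <= A * `|u c|) ->
  (forall y, box c s y -> `|laplacian u y| = `|u y| * `|u y| `^ a) ->
  box c (half_ratio n A a * s) y -> `|u c| / 2 <= `|u y|.
Proof.
move=> n0 oO su a0 A1 s0 m0 sm bO uA lap cy.
set m := `|u c| in m0 sm uA *.
have A0 : 0 < A by lra.
have n1 : 1 <= n%:R :> R by rewrite ler1n.
have Aa0 : 0 < A `^ a by exact: powR_gt0.
have s20 : 0 < s ^+ 2 by rewrite exprn_gt0.
pose K := 2 * n%:R * A + A * A `^ a / 2.
have K1 : 1 <= K.
  have : 0 <= A * A `^ a / 2 by rewrite divr_ge0// mulr_ge0// ltW.
  by rewrite /K; nra.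
have deltaE : n%:R * half_ratio n A a * K = 2^-1.
  by rewrite /half_ratio -/K; field; rewrite !gt_eqF//; lra.
have delta_le : half_ratio n A a * s <= s / 2.
  by rewrite mulrC ler_pM2l// half_ratio_le_half.
(* The factor [2] in the bound on the Laplacian makes the inequality strict, as the comparison
   requires. *)
have := @box_oscillation_le R n u (fun i => partial i (partial i u)) c y s
  (half_ratio n A a * s) (A * m) (2 * (A * A `^ a) * m / s ^+ 2) s0 delta_le.
have -> : n%:R * (half_ratio n A a * s *
    (n%:R * (A * m) / (s / 2) + 2 * (A * A `^ a) * m / s ^+ 2 * (s / 2) / 2)) = m / 2.
  transitivity (n%:R * half_ratio n A a * K * m).
    by rewrite /K; field; rewrite gt_eqF.
  by rewrite deltaE mulrC.
move=> osc.
have : `|u y - u c| <= m / 2.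
  apply: osc => //.
  - by move=> z /bO Oz; exact: (su [::] z Oz).1.
  - by move=> z i /bO Oz; exact: smooth_second_derive Oz.
  - move=> z cz; rewrite -/(laplacian u z) lap//.
    have : `|u z| * `|u z| `^ a <= A * m * (A `^ a * m `^ a).
      rewrite -powRM ?(ltW A0) ?(ltW m0)//; apply: ler_pM; rewrite ?powR_ge0 ?uA//.
      by apply: ge0_ler_powR; rewrite // ?nnegrE ?mulr_ge0 ?(ltW A0) ?(ltW m0) ?uA.
    move=> /le_lt_trans; apply.
    have -> : A * m * (A `^ a * m `^ a) = A * A `^ a * m * m `^ a by ring.
    have -> : 2 * (A * A `^ a) * m / s ^+ 2 = A * A `^ a * m * (2 / s ^+ 2) by ring.
    rewrite ltr_pM2l ?mulr_gt0// ltr_pdivlMr// mulrC; lra.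
have := ler_normD (u c - u y) (u y); rewrite subrK distrC -/m.
lra.
Qed.

End lower_bounds.

(** * A polynomial weight and a weighted maximum *)

Section point_picking.
Context {R : realType} {n : nat}.
Implicit Types (x y : 'rV[R]_n) (u : 'rV[R]_n -> R).

(* A polynomial substitute for the distance to the sphere of radius
   [sqrt (1/2)] about [x0]. *)
Definition weight x0 x : R := 2^-1 - \sum_i ((x - x0) ord0 i) ^+ 2.

Lemma weight_continuous x0 : continuous (weight x0).
Proof.
move=> x; apply: (@cvgB _ _ _ (nbhs x)); first exact: cvg_cst.
apply: (@continuous_comp _ _ _ (fun x => x - x0)
  (fun x : 'rV[R]_n => \sum_i x ord0 i ^+ 2)); last exact: sum_sqr_continuous.
by apply: (@cvgB _ _ _ (nbhs x)); [exact: cvg_id|exact: cvg_cst].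
Qed.

Lemma weight_le_half x0 x : weight x0 x <= 2^-1.
Proof. by rewrite gerBl sumr_ge0// => i _; exact: sqr_ge0. Qed.

Lemma weight_ge0_coord x0 x i : 0 <= weight x0 x -> `|x ord0 i - x0 ord0 i| <= 1.
Proof.
rewrite subr_ge0 (bigD1 i)//= => xi.
have : 0 <= \sum_(j < n | j != i) (x - x0) ord0 j ^+ 2.
  by apply: sumr_ge0 => j _; exact: sqr_ge0.
have : (x ord0 i - x0 ord0 i) ^+ 2 = ((x - x0) ord0 i) ^+ 2 by rewrite !mxE.
rewrite ler_norml; move: (x ord0 i - x0 ord0 i) xi => v; nra.
Qed.

Lemma weight_eball x0 x (r : R) : 0 <= r -> eball x0 r x -> 2^-1 - r ^+ 2 <= weight x0 x.
Proof.
move=> r0; rewrite /eball/= /enorm => xr; rewrite lerB//.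
have S0 : 0 <= \sum_i ((x - x0) ord0 i) ^+ 2.
  by apply: sumr_ge0 => i _; exact: sqr_ge0.
by rewrite -(sqr_sqrtr S0) ler_sqr ?nnegrE ?sqrtr_ge0// ltW.
Qed.

Lemma weight_ge0_eball x0 x : 0 <= weight x0 x -> eball x0 1 x.
Proof.
rewrite subr_ge0 /eball/= /enorm => S1.
by rewrite -[ltRHS]sqrtr1 ltr_sqrt//; lra.
Qed.

(** The coordinates of [x - x0] are at most [1] in size and [s <= 1], so each square grows by at
    most [s^2 + 2 s <= 3 s]. The weight loses at most [3 n s], no more than half its value. *)
Lemma weight_box x0 x y (s : R) : (0 < n)%N -> 0 <= s ->
  s <= weight x0 x / (6 * n%:R) -> box x s y ->
  weight x0 x / 2 <= weight x0 y.
Proof.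
move=> n0 s0 sW xy.
have n0R : 1 <= n%:R :> R by rewrite ler1n.
have sW' : s * (6 * n%:R) <= weight x0 x.
  by move: sW; rewrite ler_pdivlMr// mulr_gt0//; lra.
have W0 : 0 <= weight x0 x by apply: le_trans sW'; rewrite mulr_ge0//; lra.
have s1 : s <= 1 by have := weight_le_half x0 x; nra.
suff : \sum_i ((y - x0) ord0 i) ^+ 2 <= \sum_i ((x - x0) ord0 i) ^+ 2 + n%:R * (3 * s).
  by move: sW'; rewrite /weight; lra.
have -> : n%:R * (3 * s) = \sum_(i < n) (3 * s).
  by rewrite sumr_const card_ord mulr_natl.
rewrite -big_split/=; apply: ler_sum => i _; rewrite !mxE.
have := weight_ge0_coord x0 x i W0; have := xy i.
rewrite !ler_norml.
have -> : y ord0 i - x0 ord0 i = (y ord0 i - x ord0 i) + (x ord0 i - x0 ord0 i) by ring.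
move: (y ord0 i - x ord0 i) (x ord0 i - x0 ord0 i) => h v hs v1; nra.
Qed.

(** The set where the weight is nonnegative contains [x0] and is closed inside a cube, hence
    compact. *)
Lemma exists_weighted_max x0 u (e : nat) :
  (forall x, 0 <= weight x0 x -> {for x, continuous u}) ->
  exists2 x1, 0 <= weight x0 x1 & forall x, 0 <= weight x0 x ->
    weight x0 x ^+ e * u x ^+ 2 <= weight x0 x1 ^+ e * u x1 ^+ 2.
Proof.
move=> cu; pose K : set 'rV[R]_n := [set x | 0 <= weight x0 x].
have K0 : K x0.
  by rewrite /K/= /weight subrr big1 => [|i _]; rewrite ?mxE ?expr0n// subr0.
have cK : compact K.
  apply: (@subclosed_compact _ _ (box x0 1)).
  - apply: (@closed_comp _ _ (weight x0) [set r : R | 0 <= r]).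
      by move=> x _; exact: weight_continuous.
    exact: closed_ge.
  - rewrite box_itv; apply: (@rV_compact R n
      (fun i => `[x0 ord0 i - 1, x0 ord0 i + 1]%classic)) => i.
    exact: segment_compact.
  - by move=> x Kx i; exact: weight_ge0_coord.
have cF : {within K, continuous (fun x => weight x0 x ^+ e * u x ^+ 2)}.
  apply: continuous_in_subspaceT => x /set_mem Kx.
  apply: (@cvgM _ _ (nbhs x)).
    apply: (@continuous_comp _ _ _ (weight x0) (fun r : R => r ^+ e)).
      exact: weight_continuous.
    exact: exprn_continuous.
  apply: (@continuous_comp _ _ _ u (fun r : R => r ^+ 2)); first exact: cu.
  exact: exprn_continuous.
have [x1 /set_mem Kx1 x1max] := EVT_max_rV (ex_intro _ x0 K0) cK cF.
by exists x1 => // x Kx; apply: x1max; exact: mem_set.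
Qed.

End point_picking.

(** * Explicit constants, energy on a small cube, and the bound on the half ball *)

Section epsilon_regularity.
Context {R : realType} (n : nat).

(** Near the maximum point [u^2 <= 2^(n-2) m^2]; leaving out the square root in [A] keeps the
    exponent natural. *)
Let A : R := 2 ^+ (n - 2).
Let a : R := 4 / (n%:R - 2).
Let p : R := sobolev_exp R n.

(** The inverse of the integral of [(1/2)^p] over a cube of half-width [half_ratio n A a]. *)
Definition energy_cst : R := 2 `^ p / (2 * half_ratio n A a) ^+ n.

(** Solves [m^p (W / 6n)^n <= energy_cst * eps] for [W^((n-2)/2) m]; the factor [2^(n-2)] is
    [4^((n-2)/2)], as the weight is at least [1/4] on the half ball. *)
Definition sup_cst (eps : R) : R :=
  2 ^+ (n - 2) * (energy_cst * (6 * n%:R) ^+ n * eps) `^ p^-1.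

Context (n3 : (3 <= n)%N).

Let n0 : (0 < n)%N. Proof. exact: leq_trans n3. Qed.

Let n0R : 0 < n%:R :> R. Proof. by rewrite ltr0n. Qed.

Let natr_sub2 : (n - 2)%:R = n%:R - 2 :> R.
Proof. by rewrite natrB// (leq_trans _ n3). Qed.

Let n2_gt0 : 0 < n%:R - 2 :> R.
Proof. by rewrite -natr_sub2 ltr0n subn_gt0. Qed.

Let A1 : 1 <= A. Proof. by rewrite exprn_ege1// ler1n. Qed.

Let A0 : 0 <= A. Proof. exact: le_trans A1. Qed.

Let delta0 : 0 < half_ratio n A a. Proof. exact: half_ratio_gt0. Qed.

Let a0 : 0 < a. Proof. by rewrite divr_gt0. Qed.

Let p0 : 0 < p. Proof. by rewrite /p /sobolev_exp divr_gt0// mulr_gt0. Qed.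

Lemma energy_cst_gt0 : 0 < energy_cst.
Proof. by rewrite divr_gt0 ?powR_gt0// exprn_gt0// mulr_gt0. Qed.

Let sup_energy_cst_gt0 : 0 < energy_cst * (6 * n%:R) ^+ n.
Proof. by rewrite mulr_gt0 ?energy_cst_gt0// exprn_gt0// mulr_gt0. Qed.

Lemma sup_cst_gt0 eps : 0 < eps -> 0 < sup_cst eps.
Proof.
by move=> eps0; rewrite mulr_gt0 ?exprn_gt0// powR_gt0// mulr_gt0.
Qed.

Lemma sup_cst_cvg0 : sup_cst eps @[eps --> 0^'+] --> (0 : R).
Proof.
pose c := energy_cst * (6 * n%:R) ^+ n.
have c0 : 0 < c by [].
have lim0 : 2 ^+ (n - 2) * c `^ p^-1 * (eps `^ p^-1) @[eps --> 0^'+] --> (0 : R).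
  rewrite -[X in _ --> X](mulr0 (2 ^+ (n - 2) * c `^ p^-1)).
  apply: (@cvgM _ _ (0^'+ : set_system R)); first exact: cvg_cst.
  by apply: powR_cvg0; rewrite invr_gt0.
apply: cvg_trans lim0; apply: near_eq_cvg; near=> eps.
have eps0 : 0 < eps by near: eps; exact: nbhs_right_gt.
by rewrite /sup_cst -/c powRM ?(ltW c0) ?(ltW eps0)// mulrA.
Unshelve. all: by end_near. Qed.

Lemma energy_ge (D : set 'rV[R]_n) (c : 'rV[R]_n) (u v : 'rV[R]_n -> R) (m s eps : R) :
  0 <= m -> 0 < s ->
  (forall y, box c (half_ratio n A a * s) y -> m / 2 <= `|u y|) ->
  box c (half_ratio n A a * s) `<=` D ->
  (\int[lebesgue_rV R n]_(x in D) (v x ^+ 2 + `|u x| `^ p)%:E <= eps%:E)%E ->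
  m `^ p * s ^+ n <= energy_cst * eps.
Proof.
move=> m0 s0 um bD Deps.
have : (((m / 2) `^ p)%:E * lebesgue_rV R n (box c (half_ratio n A a * s)) <= eps%:E)%E.
  apply: le_trans Deps; apply: ge_cst_integral => //.
  - exact: measurable_box.
  - exact: powR_ge0.
  - by move=> x _; rewrite lee_fin addr_ge0 ?sqr_ge0 ?powR_ge0.
  - move=> x /um umx; rewrite lee_fin (@le_trans _ _ (`|u x| `^ p))//.
      by apply: ge0_ler_powR; rewrite ?nnegrE ?(ltW p0) ?divr_ge0.
    by rewrite lerDr sqr_ge0.
rewrite lebesgue_box; last by rewrite mulr_ge0 ?ltW.
rewrite -EFinM lee_fin => le_eps.
have -> : m `^ p * s ^+ n =
    energy_cst * ((m / 2) `^ p * (2 * (half_ratio n A a * s)) ^+ n).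
  have -> : m `^ p = (m / 2) `^ p * 2 `^ p by rewrite -powRM ?divr_ge0// divfK.
  have : 0 < (2 * half_ratio n A a) ^+ n by rewrite exprn_gt0// mulr_gt0.
  rewrite /energy_cst (mulrA 2) [(_ * s) ^+ n]exprMn.
  move: ((2 * half_ratio n A a) ^+ n) (s ^+ n) ((m / 2) `^ p) (2 `^ p) => b c1 c2 c3 b0.
  by field; rewrite gt_eqF.
by rewrite ler_pM2l ?energy_cst_gt0.
Qed.

(** The power [2 / p = (n - 2) / n] turns [m^p] into [m^2] and [W^n] into [W^(n-2)]. *)
Lemma weighted_max_le (W m eps : R) : 0 < W -> 0 < m -> 0 < eps ->
  m `^ p * (W / (6 * n%:R)) ^+ n <= energy_cst * eps ->
  (2 ^+ (n - 2)) ^+ 2 * (W ^+ (n - 2) * m ^+ 2) <= sup_cst eps ^+ 2.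
Proof.
move=> W0 m0 eps0 h.
pose E := energy_cst * (6 * n%:R) ^+ n * eps.
have E0 : 0 < E by rewrite mulr_gt0.
have mWE : m `^ p * W ^+ n <= E.
  move: h; rewrite expr_div_n mulrA ler_pdivrMr ?exprn_gt0 ?mulr_gt0//.
  by rewrite /E mulrAC.
rewrite /sup_cst -/E exprMn ler_pM2l ?exprn_gt0//.
pose q : R := p / 2.
have q0 : 0 < q by rewrite divr_gt0.
have -> : (E `^ p^-1) ^+ 2 = E `^ q^-1.
  rewrite -powR_mulrn ?powR_ge0// -powRrM; congr powR.
  by rewrite /q; field; rewrite gt_eqF.
have -> : W ^+ (n - 2) * m ^+ 2 = (m `^ p * W ^+ n) `^ q^-1.
  rewrite powRM ?powR_ge0 ?exprn_ge0 ?(ltW W0)// -powRrM -!powR_mulrn ?(ltW W0) ?(ltW m0)//.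
  rewrite -powRrM mulrC; congr (powR _ _ * powR _ _).
    rewrite /q; field; rewrite !gt_eqF//.
  rewrite /q /p /sobolev_exp natr_sub2; field; rewrite !gt_eqF//.
apply: ge0_ler_powR; rewrite ?nnegrE ?invr_ge0 ?(ltW q0) ?(ltW E0)//.
by rewrite mulr_ge0 ?powR_ge0 ?exprn_ge0 ?ltW.
Qed.

Lemma sup_le (Omega : set 'rV[R]_n) (u : 'rV[R]_n -> R) (x0 : 'rV[R]_n) (eps : R) :
  open Omega -> smooth_on Omega u ->
  (forall x, Omega x -> - laplacian u x = u x * `|u x| `^ a) ->
  eball x0 1 `<=` Omega ->
  0 < eps <= (2 * energy_cst)^-1 ->
  (\int[lebesgue_rV R n]_(x in eball x0 1)
     (enorm (grad u x) ^+ 2 + `|u x| `^ p)%:E <= eps%:E)%E ->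
  forall x, eball x0 2^-1 x -> `|u x| <= sup_cst eps.
Proof.
move=> oO su eq_u bO /andP[eps0 eps1] energy x xball.
have wO y : 0 <= weight x0 y -> Omega y by move=> /weight_ge0_eball/bO.
(* Lengths scale like [|u|^(-2/(n-2))], so [w^(n-2) u^2] is scale invariant; squaring [u] makes the
   exponent of [w] natural. *)
have [y wy|x1 W0 x1max] := exists_weighted_max x0 u (n - 2).
  by have [] := su [::] y (wO _ wy).
set W := weight x0 x1 in W0 x1max.
have wx : 2^-1 ^+ 2 <= weight x0 x.
  apply: le_trans (weight_eball _ _ _ _ xball); last by rewrite invr_ge0.
  by rewrite expr2; lra.
have ux : (u x) ^+ 2 <= (2 ^+ (n - 2)) ^+ 2 * (W ^+ (n - 2) * u x1 ^+ 2).
  rewrite -ler_pdivrMl ?exprn_gt0//; apply: le_trans (x1max x _); last first.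
    by apply: le_trans wx; rewrite exprn_ge0.
  apply: ler_wpM2r; first exact: sqr_ge0.
  rewrite -exprVn -exprVn exprAC; apply: lerXn2r => //; rewrite nnegrE ?exprn_ge0//.
  by apply: le_trans wx; rewrite exprn_ge0.
suff : (2 ^+ (n - 2)) ^+ 2 * (W ^+ (n - 2) * u x1 ^+ 2) <= sup_cst eps ^+ 2.
  move=> /(le_trans ux); rewrite -[u x ^+ 2]real_normK ?num_real//.
  by rewrite ler_sqr ?nnegrE// ltW// sup_cst_gt0.
(* A zero maximum makes the bound trivial; otherwise both [m] and [W] are positive, the latter
   because [n - 2 > 0]. *)
have [Wm0|Wm0] := leP (W ^+ (n - 2) * u x1 ^+ 2) 0.
  apply: (@le_trans _ _ 0); last exact: sqr_ge0.
  by rewrite mulr_ge0_le0// sqr_ge0.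
have m0 : 0 < `|u x1|.
  rewrite normr_gt0; apply: contraTneq Wm0 => ->.
  by rewrite expr0n mulr0 ltxx.
have {}W0 : 0 < W.
  rewrite lt_neqAle W0 andbT; apply: contraTneq Wm0 => <-.
  by rewrite expr0n subn_eq0 leqNgt n3 mul0r ltxx.
rewrite -[u x1 ^+ 2]real_normK ?num_real//.
set m := `|u x1| in m0 *.
(* The first bound keeps the weight above [W / 2] on the cube, the second ensures [s^2 m^a <= 1]. *)
pose s := Num.min (W / (6 * n%:R)) (m `^ (- (a / 2))).
have s0 : 0 < s.
  by rewrite lt_min divr_gt0 ?mulr_gt0//= powR_gt0.
have s_leW : s <= W / (6 * n%:R) by rewrite ge_min lexx.
have s_lem : s <= m `^ (- (a / 2)) by rewrite ge_min lexx orbT.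
have boxW y : box x1 s y -> W / 2 <= weight x0 y.
  by move=> sy; apply: weight_box sy => //; rewrite ltW.
have box_ge0 y : box x1 s y -> 0 <= weight x0 y.
  by move=> /boxW; apply: le_trans; rewrite divr_ge0// ltW.
have half_le : half_ratio n A a * s <= s.
  rewrite -[leRHS]mul1r ler_pM2r//.
  by have := half_ratio_le_half n A a n0 A1; lra.
have box_half y : box x1 (half_ratio n A a * s) y -> box x1 s y.
  by move=> hy i; exact: le_trans (hy i) half_le.
have key : m `^ p * s ^+ n <= energy_cst * eps.
  apply: (@energy_ge (eball x0 1) x1 u (fun x => enorm (grad u x))) => //; first exact: ltW.
    move=> y; apply: (@half_lower_bound _ _ Omega) => //.
    - exact: ltW.
    - rewrite -/m -ler_pdivlMr ?powR_gt0// div1r -powRN.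
      have -> : m `^ (- a) = (m `^ (- (a / 2))) ^+ 2.
        by rewrite -powR_mulrn ?powR_ge0// -powRrM; congr powR; field.
      by rewrite ler_sqr ?nnegrE ?powR_ge0// ltW.
    - by move=> z /box_ge0/wO.
    - move=> z sz; rewrite -/m -ler_sqr ?nnegrE ?mulr_ge0 ?(ltW m0)//.
      have Wz := boxW _ sz; have /x1max := box_ge0 _ sz.
      have W2 : 0 < W / 2 by rewrite divr_gt0.
      have le_wz : (W / 2) ^+ (n - 2) <= weight x0 z ^+ (n - 2).
        by apply: lerXn2r; rewrite ?nnegrE ?(ltW W2) ?box_ge0.
      (* Maximality with weight at least [W / 2] gives [u(z)^2 <= 2^(n-2) m^2], and
         [2^(n-2) <= A^2]. *)
      move=> /(le_trans (ler_wpM2r (sqr_ge0 (u z)) le_wz)).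
      rewrite expr_div_n mulrAC ler_pdivrMr ?exprn_gt0// -mulrA.
      rewrite ler_pM2l ?exprn_gt0// real_normK ?num_real// => /le_trans; apply.
      rewrite exprMn mulrC /m real_normK ?num_real// ler_wpM2r ?sqr_ge0//.
      by rewrite expr2 ler_peMl.
    - by move=> z /box_ge0/wO/eq_u/(congr1 Num.norm);
        rewrite normrN normrM (ger0_norm (powR_ge0 _ _)).
  by move=> y /box_half/box_ge0/weight_ge0_eball.
apply: weighted_max_le => //.
(* Otherwise [s = m^(-a/2)], so [s^n = m^(-p)] since [a n / 2 = p], and [key] reads
   [1 <= energy_cst * eps], whereas [eps] was taken so small that the right-hand side is at most
   [1/2]. *)
suff <- : s = W / (6 * n%:R) by [].
apply/min_idPl; rewrite leNgt; apply/negP => slt.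
have sE : s = m `^ (- (a / 2)) by apply/min_idPr/ltW.
move: key; rewrite sE -powR_mulrn ?powR_ge0// -powRrM.
have -> : - (a / 2) * n%:R = - p.
  by rewrite /a /p /sobolev_exp; field; rewrite gt_eqF.
rewrite -powRD ?(gt_eqF m0) ?implybT// subrr powRr0.
have := energy_cst_gt0 => c0.
have : energy_cst * eps <= 2^-1.
  by rewrite -ler_pdivlMl// -invfM [energy_cst * 2]mulrC.
lra.
Qed.

End epsilon_regularity.

Theorem theorem1p2 (R : realType) (n : nat) (hn : (3 <= n)%N) :
  exists (eps0 r0 : R) (C : R -> R),
    [/\ 0 < eps0,
        0 < r0,
        (forall eps, 0 < eps <= eps0 -> 0 < C eps),
        C eps @[eps --> 0^'+] --> (0 : R) &
        forall (Omega : set 'rV[R]_n) (u : 'rV[R]_n -> R) (x0 : 'rV[R]_n)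
               (eps : R),
          open Omega ->
          in_H1 Omega u ->
          in_Lp Omega (sobolev_exp R n) u ->
          smooth_on Omega u ->
          (forall x, Omega x ->
             - laplacian u x = u x * `|u x| `^ (4 / (n%:R - 2))) ->
          Omega x0 ->
          eball x0 r0 `<=` Omega ->
          0 < eps <= eps0 ->
          (\int[lebesgue_rV R n]_(x in eball x0 r0)
             (enorm (grad u x) ^+ 2 + `|u x| `^ sobolev_exp R n)%:E
           <= eps%:E)%E ->
          forall r : R, 0 < r < r0 ->
            (Linf_norm (eball x0 (r / 2)) u
             <= (C eps / r `^ ((n%:R - 2) / 2))%:E)%E].

Proof.
exists (2 * energy_cst n)^-1, 1, (sup_cst n); split => //.
- by rewrite invr_gt0 mulr_gt0// energy_cst_gt0.
- by move=> eps /andP[eps0 _]; exact: sup_cst_gt0.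
- exact: sup_cst_cvg0.
move=> Omega u x0 eps oO _ _ su eq_u _ bO eps_bounds energy r /andP[r0 r1].
(* One bound on the ball of radius [1/2] serves all [r < 1], since then [r^((n-2)/2) <= 1]. *)
have sup x : eball x0 (r / 2) x -> `|u x| <= sup_cst n eps / r `^ ((n%:R - 2) / 2).
  move=> xr; have x_half : eball x0 2^-1 x by apply: (lt_trans xr); lra.
  have := sup_le n hn Omega u x0 eps oO su eq_u bO eps_bounds energy x x_half.
  move=> /le_trans; apply.
  have eps0 : 0 < eps by case/andP: eps_bounds.
  rewrite ler_peMr ?(ltW (sup_cst_gt0 _ hn _ eps0))// invf_ge1 ?powR_gt0//.
  rewrite -[leRHS](powRr0 r); apply: ger_powR; first by rewrite r0 ltW.
  by rewrite divr_ge0// subr_ge0 ler_nat (leq_trans _ hn).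
have C0 : (0 <= (sup_cst n eps / r `^ ((n%:R - 2) / 2))%:E)%E.
  rewrite lee_fin divr_ge0 ?powR_ge0// ltW// sup_cst_gt0//.
  by case/andP: eps_bounds.
(* The norm is an essential supremum, so a pointwise bound suffices; off the ball the function is
   [0] and [C0] applies. *)
rewrite /Linf_norm unlock; case: ifP => // _.
apply/ess_sup_inf.ess_supP; apply: aeW => x /=.
rewrite patchE; case: ifPn => [/set_mem/sup|_]; first by rewrite lee_fin.
by rewrite normr0.
Qed.
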